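(* Let $k$ be a field, and let $L_1,L_2$ be $L$-algebras over $k$ with $k$-bases $X=\{x_i\mid i\in I\}$ and $Y=\{y_j\mid j\in J\}$ respectively, $X$ and $Y$ disjoint, and let $X\cup Y$ be well-ordered. Write $\{x_i\prec x_j\},\{x_i\succ x_j\}$ for the products in $L_1$ expressed as linear combinations of elements of $X$, and similarly $\{y_i\prec y_j\},\{y_i\succ y_j\}$ for $L_2$ and $Y$. Put $$S_1=\{x_i\prec x_j-\{x_i\prec x_j\},\ x_i\succ x_j-\{x_i\succ x_j\}\mid i,j\in I\},$$ $$S_2=\{y_i\prec y_j-\{y_i\prec y_j\},\ y_i\succ y_j-\{y_i\succ y_j\}\mid i,j\in J\},$$ and let $S=S_1\cup S_2\cup F_1\cup F_2\subset L(X\cup Y)$, where $$F_1=\{x_i\succ((((x_j\prec u)\prec v_1)\prec\cdots)\prec v_n)-(((\{x_i\succ x_j\}\prec u)\prec v_1)\prec\cdots)\prec v_n\}$$ over all $i,j\in I$, $n\in\mathbb N=\{0,1,2,\dots\}$, $u\in Irr(S_1\cup S_2)\setminus X$, $v_1,\dots,v_n\in Irr(S_1\cup S_2)$, and $$F_2=\{y_i\succ((((y_j\prec u)\prec v_1)\prec\cdots)\prec v_n)-(((\{y_i\succ y_j\}\prec u)\prec v_1)\prec\cdots)\prec v_n\}$$ over all $i,j\in J$, $n\in\mathbb N$, $u\in Irr(S_1\cup S_2)\setminus Y$, $v_1,\dots,v_n\in Irr(S_1\cup S_2)$. Then $Irr(S)$ is a $k$-basis of the free product $L_1*L_2=L(X\cup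 Y|S_1\cup S_2)$.
   Context: An $L$-algebra over $k$ is a $k$-space with two bilinear operations $\prec,\succ$ satisfying $(x\succ y)\prec z=x\succ(y\prec z)$. The free product $L_1*L_2$ is the coproduct of $L_1$ and $L_2$ in the category of $L$-algebras over $k$. For a well-ordered set $Z$ and $\Omega=\{\prec,\succ\}$: $(Z,\Omega)$ (the $\Omega$-words) is the smallest set of formal expressions containing $Z$ and closed under $u,v\mapsto u\prec v$, $u\succ v$. Normal words: $z\in Z$; $v\succ w$ with $v,w$ normal; $v\prec w$ with $v,w$ normal and $v$ not of the form $v_1\succ v_2$. $N(Z)$ is the set of normal words. The free $L$-algebra $L(Z)$ has $k$-basis $N(Z)$ and operations given for $u,v\in N(Z)$ by: $u\succ v$ is the word $u\succ v$; $u\prec v=[u\prec v]$, where $[u\prec v]$ is the word $u\prec v$ if $u\in Z$ or $u=u_1\prec u_2$, and $[u\prec v]=u_1\succ[u_2\prec v]$ if $u=u_1\succ u_2$. For $T\subset L(Z)$, $L(Z|T)=L(Z)/Id(T)$, with $Id(T)$ the ideal (two-sided for both operations) generated by $T$. Ordering: $|u|$ is the number of occurrences of elements of $Z$ in $u$; $\delta_1$ denotes $\succ$, $\delta_2$ denotes $\prec$, $\delta_1<\delta_2$. Put $wt(z)=(1,z)$ for $z\in Z$ and $wt(u)=(|u|,\delta_i,u_1,u_2)$ for $u=\delta_i(u_1,u_2)$; $u>v$ iff $wt(u)>wt(v)$ lexicographically, recursively on $|u|+|v|$. For $0\ne f\in L(Z)$, $\overline f$ is the largest normal word occurring in $f$.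 A $\star$-$\Omega$-word is an element of $(Z\cup\{\star\},\Omega)$ ($\star\notin Z$) with exactly one occurrence of $\star$. For a $\star$-$\Omega$-word $v$ and $s\in L(Z)$, $v|_s$ is the element of $L(Z)$ obtained by substituting $s$ for $\star$; it is a normal $s$-word if the $\Omega$-word $v|_{\overline s}$ (formal substitution) lies in $N(Z)$. For a set $T\subset L(Z)$ of polynomials with leading coefficient $1$, $Irr(T)=\{u\in N(Z)\mid u\ne v|_{\overline s}\text{ for all } s\in T\text{ and normal } s\text{-words } v|_s\}$. *)

(* Defs.v *)
From HB Require Import structures.
From mathcomp Require Import all_boot all_algebra finmap.
From mathcomp Require Import generic_quotient ring_quotient.
From mathcomp Require Import boolp classical_sets wochoice.
From mathcomp Require Import monalg.

Set Implicit Arguments.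
Unset Strict Implicit.
Unset Printing Implicit Defensive.

Import GRing.Theory.
Local Open Scope classical_set_scope.
Local Open Scope ring_scope.
Local Open Scope quotient_scope.

(** L-algebras; not to be confused with MathComp's [lalgType]. *)

HB.mixin Record Lmodule_isLAlg (k : fieldType) A of GRing.Lmodule k A := {
  lprec : A -> A -> A;
  lsucc : A -> A -> A;
  lprec_linearr : forall x, linear (lprec x);
  lprec_linearl : forall y, linear (lprec^~ y);
  lsucc_linearr : forall x, linear (lsucc x);
  lsucc_linearl : forall y, linear (lsucc^~ y);
  lsucc_precA : forall x y z, lprec (lsucc x y) z = lsucc x (lprec y z)
}.

#[short(type="LAlgType")]
HB.structure Definition LAlg (k : fieldType) :=
  {A of GRing.Lmodule k A & Lmodule_isLAlg k A}.

Definition lalg_hom (k : fieldType) (A B : LAlgType k) (f : A -> B) : Prop :=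
  [/\ linear f, {morph f : x y / lprec x y >-> lprec x y}
    & {morph f : x y / lsucc x y >-> lsucc x y}].

Definition is_coproduct (k : fieldType) (A B P : LAlgType k)
    (i : A -> P) (j : B -> P) : Prop :=
  [/\ lalg_hom i, lalg_hom j
    & forall (C : LAlgType k) (f : A -> C) (g : B -> C),
        lalg_hom f -> lalg_hom g ->
        exists! h : P -> C, [/\ lalg_hom h, h \o i = f & h \o j = g]].

Section Basis.
Variables (k : fieldType) (I : choiceType) (V : lmodType k).
Implicit Types (x : I -> V) (c : {malg k[I]}).

Definition lincomb x c : V := \sum_(i <- msupp c) c@_i *: x i.

Definition is_basis x : Prop :=
  (forall c, lincomb x c = 0 -> c = 0) /\ (forall v, exists c, lincomb x c = v).

(* The default value is never used when [x] is a basis. *)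
Definition coord x (v : V) : {malg k[I]} := xget 0 [set c | lincomb x c = v].

Lemma lincombEw x c (d : {fset I}) :
  (msupp c `<=` d)%fset -> lincomb x c = \sum_(i <- d) c@_i *: x i.
Proof.
move=> /fsubsetP le_cd; rewrite /lincomb.
rewrite [RHS](bigID (fun i => i \in msupp c)) /= [X in _ + X]big1 ?addr0; last first.
  by move=> i /mcoeff_outdom ->; rewrite scale0r.
rewrite -[RHS]big_filter; apply: perm_big; apply: uniq_perm.
- exact: fset_uniq.
- by rewrite filter_uniq ?fset_uniq.
- move=> i; rewrite mem_filter; case: (boolP (i \in msupp c)) => //=.
  by move/le_cd => ->.
Qed.

Lemma lincomb_linear x : linear (lincomb x).
Proof.
move=> a c d; pose D := (msupp c `|` msupp d)%fset.
rewrite (@lincombEw x c D) ?fsubsetUl // (@lincombEw x d D) ?fsubsetUr //.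
rewrite (@lincombEw x _ D); last first.
  apply: fsubset_trans (msuppD_le _ _) _; apply: fsetSU.
  exact: msuppZ_le.
rewrite scaler_sumr -big_split /=; apply: eq_bigr => i _.
by rewrite mcoeffD mcoeffZ scalerDl scalerA.
Qed.

Lemma lincombU x i : lincomb x << i >> = x i.
Proof.
rewrite (@lincombEw x _ [fset i]%fset) ?msuppU_le //.
by rewrite big_seq_fset1 mcoeffUU scale1r.
Qed.

End Basis.

Section LinearExtension.
Variables (k : fieldType) (I : choiceType) (V : lmodType k).

Lemma lincombDx (x y : I -> V) a (c : {malg k[I]}) :
  lincomb (fun i => a *: x i + y i) c = a *: lincomb x c + lincomb y c.
Proof.
rewrite /lincomb scaler_sumr -big_split /=; apply: eq_bigr => i _.
by rewrite scalerDr !scalerA mulrC.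
Qed.

Lemma linear_lincomb (U : lmodType k) (f : V -> U) (x : I -> V)
    (c : {malg k[I]}) :
  linear f -> f (lincomb x c) = lincomb (fun i => f (x i)) c.
Proof.
move=> lf; have f0 : f 0 = 0.
  by have := lf (-1) 0 0; rewrite scaler0 addr0 scaleN1r addNr.
rewrite /lincomb; elim/big_rec2: _ => [//|i u v _ <-].
by rewrite lf.
Qed.

End LinearExtension.

(** Omega-words. The order of the constructors of [lop] matches
    [delta_1 = Succ < delta_2 = Prec]. *)

Inductive lop := Succ | Prec.

Inductive word (Z : Type) := Gen of Z | Node of lop & word Z & word Z.
Arguments Gen {Z} _.
Arguments Node {Z} _ _ _.

Definition bool_of_lop d := if d is Prec then true else false.
Definition lop_of_bool b := if b then Prec else Succ.
Lemma bool_of_lopK : cancel bool_of_lop lop_of_bool. Proof. by case. Qed.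
HB.instance Definition _ := Choice.copy lop (can_type bool_of_lopK).

Definition lop_lt (d e : lop) : bool :=
  if (d, e) is (Succ, Prec) then true else false.

Section WordChoice.
Variable Z : choiceType.

Fixpoint tree_of_word (w : word Z) : GenTree.tree Z :=
  match w with
  | Gen z => GenTree.Leaf z
  | Node d u v =>
      GenTree.Node (bool_of_lop d) [:: tree_of_word u; tree_of_word v]
  end.

Fixpoint word_of_tree (t : GenTree.tree Z) : option (word Z) :=
  match t with
  | GenTree.Leaf z => Some (Gen z)
  | GenTree.Node n [:: t1; t2] =>
      match word_of_tree t1, word_of_tree t2 with
      | Some u, Some v => Some (Node (lop_of_bool (n == 1%N)) u v)
      | _, _ => None
      end
  | _ => None
  end.

Lemma tree_of_wordK : pcancel tree_of_word word_of_tree.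
Proof. by elim=> //= -[] u -> v ->. Qed.

HB.instance Definition _ := Choice.copy (word Z) (pcan_type tree_of_wordK).

End WordChoice.

Fixpoint wsize (Z : Type) (w : word Z) : nat :=
  match w with Gen _ => 1%N | Node _ u v => (wsize u + wsize v)%N end.

Definition is_succ (Z : Type) (w : word Z) : bool :=
  if w is Node Succ _ _ then true else false.

Fixpoint normal (Z : Type) (w : word Z) : bool :=
  match w with
  | Gen _ => true
  | Node Succ u v => normal u && normal v
  | Node Prec u v => [&& normal u, normal v & ~~ is_succ u]
  end.

(* The strict order [u < v]: lexicographic comparison of [wt u] and [wt v],
   for the weak order [leZ] on the generators. *)
Fixpoint word_lt (Z : choiceType) (leZ : rel Z) (u v : word Z) : bool :=
  (wsize u < wsize v)%N ||
  (wsize u == wsize v) &&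
  match u, v with
  | Gen a, Gen b => (a != b) && leZ a b
  | Node d u1 u2, Node e v1 v2 =>
      lop_lt d e ||
      (d == e) && (word_lt leZ u1 v1 || (u1 == v1) && word_lt leZ u2 v2)
  | _, _ => false
  end.

(* [N(Z)] *)
Definition nword (Z : choiceType) := {w : word Z | normal w}.

Section NormalWord.
Variable Z : choiceType.
Implicit Types u v : nword Z.

HB.instance Definition _ := Choice.on (nword Z).

Fixpoint word_prec (u v : word Z) : word Z :=
  match u with
  | Node Succ u1 u2 => Node Succ u1 (word_prec u2 v)
  | _ => Node Prec u v
  end.

Lemma normal_prec (u v : word Z) :
  normal u -> normal v -> normal (word_prec u v).
Proof.
move=> nu nv; elim: u nu => [z|d u1 _ u2 IH] /=; first by rewrite nv.
case: d => /=; first by case/andP=> -> /IH ->.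
by move=> ->; rewrite nv.
Qed.

Definition ngen (z : Z) : nword Z := exist _ (Gen z) isT.

Definition nprec u v : nword Z :=
  exist _ (word_prec (val u) (val v)) (normal_prec (valP u) (valP v)).

Lemma normal_succ u v : normal (Node Succ (val u) (val v)).
Proof. by rewrite /= (valP u) (valP v). Qed.

Definition nsucc u v : nword Z :=
  exist _ (Node Succ (val u) (val v)) (normal_succ u v).

Lemma nsucc_precA u v w : nprec (nsucc u v) w = nsucc u (nprec v w).
Proof. exact: val_inj. Qed.

End NormalWord.

(** The free L-algebra [L(Z)]. *)

(* Finitely supported functions on [N(Z)]. *)
Definition free_lalg (k : fieldType) (Z : choiceType) := {malg k[nword Z]}.

Section FreeLAlg.
Variables (k : fieldType) (Z : choiceType).
Local Notation LZ := (free_lalg k Z).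

HB.instance Definition _ := GRing.Lmodule.on LZ.

Definition mono (u : nword Z) : LZ := << u >>.

Definition bilin (op : nword Z -> nword Z -> nword Z) (f g : LZ) : LZ :=
  lincomb (fun u => lincomb (fun v => mono (op u v)) g) f.

Lemma bilin_linearr op f : linear (bilin op f).
Proof.
move=> a g h; apply: etrans (lincombDx _ _ a f); congr (lincomb _ f).
by apply/funext => u; apply: (lincomb_linear (fun v => mono (op u v))).
Qed.

Lemma bilin_linearl op g : linear (bilin op ^~ g).
Proof. by move=> a f h; apply: lincomb_linear. Qed.

Lemma bilinU op u g : bilin op (mono u) g = lincomb (fun v => mono (op u v)) g.
Proof. exact: (lincombU (fun u => lincomb (fun v => mono (op u v)) g)). Qed.

Lemma free_lsucc_precA (f g h : LZ) :
  bilin (@nprec Z) (bilin (@nsucc Z) f g) h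
  = bilin (@nsucc Z) f (bilin (@nprec Z) g h).
Proof.
pose S u w := mono (nsucc u w); pose P v w := mono (nprec v w).
have Plin := bilin_linearl (@nprec Z) h.
have Slin u := lincomb_linear (S u).
have PS u v : bilin (@nprec Z) (S u v) h = lincomb (S u) (lincomb (P v) h).
  have E w : mono (nprec (nsucc u v) w) = lincomb (S u) (P v w).
    by rewrite nsucc_precA; exact/esym/lincombU.
  apply: etrans (bilinU _ _ _) _; apply: etrans (esym (linear_lincomb _ h (Slin u))).
  exact: (congr1 (fun F => lincomb F h) (funext E)).
have PSg u : bilin (@nprec Z) (lincomb (S u) g) h
    = lincomb (S u) (lincomb (fun v => lincomb (P v) h) g).
  apply: etrans (linear_lincomb _ g Plin) _.
  apply: etrans (esym (linear_lincomb _ g (Slin u))).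
  exact: (congr1 (fun F => lincomb F g) (funext (PS u))).
apply: etrans (linear_lincomb _ f Plin) _.
exact: (congr1 (fun F => lincomb F f) (funext PSg)).
Qed.

HB.instance Definition _ := Lmodule_isLAlg.Build k LZ
  (bilin_linearr (@nprec Z)) (bilin_linearl (@nprec Z))
  (bilin_linearr (@nsucc Z)) (bilin_linearl (@nsucc Z)) free_lsucc_precA.

End FreeLAlg.

(** Ideals and quotients. *)

Section Quotient.
Variables (k : fieldType) (A : LAlgType k).

Definition is_ideal (N : set A) : Prop :=
  [/\ N 0, forall a x y, N x -> N y -> N (a *: x + y)
    & forall x y, N x -> [/\ N (lprec x y), N (lprec y x),
                             N (lsucc x y) & N (lsucc y x)]].

(* [Id(T)] *)
Definition ideal_gen (T : set A) : set A :=
  [set x | forall N, is_ideal N -> T `<=` N -> N x].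

Lemma ideal_genP T : is_ideal (ideal_gen T).
Proof.
split=> [N [] //|a x y Nx Ny N iN TN|x y Nx].
  by case: (iN) => _ lN _; apply: lN; [exact: Nx|exact: Ny].
by split=> N iN TN; case: (iN) => _ _ /(_ x y (Nx N iN TN)) [].
Qed.

Variable T : set A.

Definition ideal_pred : {pred A} := fun x => `[< ideal_gen T x >].

Lemma ideal_pred_zmod_closed : zmod_closed ideal_pred.
Proof.
have [N0 Nl _] := ideal_genP T.
split=> [|x y /asboolP Nx /asboolP Ny]; first exact/asboolP.
by apply/asboolP; rewrite addrC -scaleN1r; apply: Nl.
Qed.

HB.instance Definition _ :=
  GRing.isZmodClosed.Build A ideal_pred ideal_pred_zmod_closed.

Definition lquot := Quotient.quot ideal_pred.

HB.instance Definition _ := GRing.Zmodule.on lquot.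
HB.instance Definition _ := EqQuotient.on lquot.

Definition lpi (x : A) : lquot := \pi_lquot x.

Lemma lpi_eq x y : lpi x = lpi y <-> ideal_gen T (x - y).
Proof.
split=> [/eqP|Nxy]; last apply/eqP.
  by rewrite piE => /asboolP.
by rewrite piE; apply/asboolP.
Qed.

Lemma lpiD x y : lpi (x + y) = lpi x + lpi y.
Proof. by rewrite /lpi !piE. Qed.

Lemma lpi_reprK (x : lquot) : lpi (repr x) = x.
Proof. exact: reprK. Qed.

Definition lq_scale (a : k) (x : lquot) : lquot := lpi (a *: repr x).
Definition lq_prec (x y : lquot) : lquot := lpi (lprec (repr x) (repr y)).
Definition lq_succ (x y : lquot) : lquot := lpi (lsucc (repr x) (repr y)).

Lemma ideal_repr x : ideal_gen T (repr (lpi x) - x).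
Proof. by apply/lpi_eq; rewrite lpi_reprK. Qed.

Lemma lpi_scale a x : lq_scale a (lpi x) = lpi (a *: x).
Proof.
apply/lpi_eq; have [N0 Nl _] := ideal_genP T.
by rewrite -scalerBr -[_ *: _]addr0; apply: Nl => //; exact: ideal_repr.
Qed.

Lemma lpi_op (op : A -> A -> A) x y :
    (forall x, linear (op x)) -> (forall y, linear (op^~ y)) ->
    (forall x y, ideal_gen T x -> ideal_gen T (op x y) /\ ideal_gen T (op y x)) ->
  lpi (op (repr (lpi x)) (repr (lpi y))) = lpi (op x y).
Proof.
move=> lr ll Nop; apply/lpi_eq; have [N0 Nl _] := ideal_genP T.
set x' := repr (lpi x); set y' := repr (lpi y).
have -> : op x' y' - op x y = 1 *: op (x' - x) y' + op x (y' - y).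
  have := ll y' (-1) x x'; rewrite /= !scaleN1r [- x + _]addrC => ->.
  have := lr x (-1) y y'; rewrite /= !scaleN1r [- y + _]addrC => ->.
  by rewrite scale1r [RHS]addrC addrA addrK addrC.
by apply: Nl; [case: (Nop (x' - x) y') | case: (Nop (y' - y) x)] => //;
  exact: ideal_repr.
Qed.

Lemma lpi_prec x y : lq_prec (lpi x) (lpi y) = lpi (lprec x y).
Proof.
apply: lpi_op; [exact: lprec_linearr|exact: lprec_linearl|].
by move=> {}x {}y Nx; have [_ _ /(_ x y Nx) []] := ideal_genP T.
Qed.

Lemma lpi_succ x y : lq_succ (lpi x) (lpi y) = lpi (lsucc x y).
Proof.
apply: lpi_op; [exact: lsucc_linearr|exact: lsucc_linearl|].
by move=> {}x {}y Nx; have [_ _ /(_ x y Nx) []] := ideal_genP T.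
Qed.

Lemma lq_scaleA a b x : lq_scale a (lq_scale b x) = lq_scale (a * b) x.
Proof. by rewrite -[x]lpi_reprK !lpi_scale scalerA. Qed.

Lemma lq_scale1 : left_id 1 lq_scale.
Proof. by move=> x; rewrite -[x]lpi_reprK lpi_scale scale1r. Qed.

Lemma lq_scaleDr : right_distributive lq_scale +%R.
Proof.
move=> a x y; rewrite -[x]lpi_reprK -[y]lpi_reprK -lpiD !lpi_scale -lpiD.
by rewrite scalerDr.
Qed.

Lemma lq_scaleDl x : {morph lq_scale^~ x : a b / a + b}.
Proof.
by move=> a b; rewrite -[x]lpi_reprK !lpi_scale -lpiD scalerDl.
Qed.

HB.instance Definition _ := GRing.Zmodule_isLmodule.Build k lquot
  lq_scaleA lq_scale1 lq_scaleDr lq_scaleDl.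

Lemma lpiZ a x : lpi (a *: x) = a *: lpi x.
Proof. by rewrite -lpi_scale. Qed.

Lemma lq_prec_linearr x : linear (lq_prec x).
Proof.
move=> a y z; rewrite -[x]lpi_reprK -[y]lpi_reprK -[z]lpi_reprK.
by rewrite -lpiZ -lpiD !lpi_prec lprec_linearr lpiD lpiZ.
Qed.

Lemma lq_prec_linearl y : linear (lq_prec^~ y).
Proof.
move=> a x z; rewrite -[x]lpi_reprK -[y]lpi_reprK -[z]lpi_reprK.
by rewrite -lpiZ -lpiD !lpi_prec lprec_linearl lpiD lpiZ.
Qed.

Lemma lq_succ_linearr x : linear (lq_succ x).
Proof.
move=> a y z; rewrite -[x]lpi_reprK -[y]lpi_reprK -[z]lpi_reprK.
by rewrite -lpiZ -lpiD !lpi_succ lsucc_linearr lpiD lpiZ.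
Qed.

Lemma lq_succ_linearl y : linear (lq_succ^~ y).
Proof.
move=> a x z; rewrite -[x]lpi_reprK -[y]lpi_reprK -[z]lpi_reprK.
by rewrite -lpiZ -lpiD !lpi_succ lsucc_linearl lpiD lpiZ.
Qed.

Lemma lq_succ_precA x y z : lq_prec (lq_succ x y) z = lq_succ x (lq_prec y z).
Proof.
rewrite -[x]lpi_reprK -[y]lpi_reprK -[z]lpi_reprK.
by rewrite !(lpi_prec, lpi_succ) lsucc_precA.
Qed.

HB.instance Definition _ := Lmodule_isLAlg.Build k lquot
  lq_prec_linearr lq_prec_linearl lq_succ_linearr lq_succ_linearl
  lq_succ_precA.

End Quotient.

(** Star words and [Irr]. A star is represented by the generator [None]. *)

Fixpoint nstars (Z : Type) (w : word (option Z)) : nat :=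
  match w with
  | Gen None => 1%N
  | Gen (Some _) => 0%N
  | Node _ u v => (nstars u + nstars v)%N
  end.

Definition star_word (Z : Type) (w : word (option Z)) : Prop := nstars w = 1%N.

Fixpoint wsubst (Z : Type) (w : word (option Z)) (s : word Z) : word Z :=
  match w with
  | Gen None => s
  | Gen (Some z) => Gen z
  | Node d u v => Node d (wsubst u s) (wsubst v s)
  end.

Section Irr.
Variables (k : fieldType) (Z : choiceType) (leZ : rel Z).
Local Notation LZ := (free_lalg k Z).

(* [w] is the leading word of [f]; there is none when [f = 0]. *)
Definition leading (f : LZ) (w : nword Z) : Prop :=
  w \in msupp f /\
  forall w', w' \in msupp f -> w' != w -> word_lt leZ (val w') (val w).

Definition Irr (T : set LZ) : set (nword Z) :=
  [set u | forall s v w, T s -> star_word v -> leading s w ->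
     normal (wsubst v (val w)) -> val u <> wsubst v (val w)].

End Irr.

(** The relations of the free product. Below, [b] is the given basis of one
    factor [L] and [inc] embeds its indices in the set [Z] of all generators. *)

Section Relations.
Variables (k : fieldType) (L : LAlgType k) (I Z : choiceType).
Variables (b : I -> L) (inc : I -> Z).
Local Notation LZ := (free_lalg k Z).

Definition gen (i : I) : LZ := mono k (ngen (inc i)).

(* [{a}]: the element [a] of [L] written as a linear combination of generators. *)
Definition expand (a : L) : LZ := lincomb gen (coord b a).

Definition table : set LZ :=
  [set f | exists i j,
     f = lprec (gen i) (gen j) - expand (lprec (b i) (b j)) \/
     f = lsucc (gen i) (gen j) - expand (lsucc (b i) (b j))].

(* [f prec v_1 prec ... prec v_n], bracketed to the left. *)
Definition prec_chain (f : LZ) (vs : seq (nword Z)) : LZ :=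
  foldl (fun g v => lprec g (mono k v)) f vs.

(* [R] stands for [Irr (S_1 `|` S_2)]. *)
Definition completion (R : set (nword Z)) : set LZ :=
  [set f | exists i j u vs,
     [/\ R u, forall l, u <> ngen (inc l), forall v, v \in vs -> R v
       & f = lsucc (gen i) (prec_chain (gen j) (u :: vs))
             - prec_chain (expand (lsucc (b i) (b j))) (u :: vs)]].

End Relations.

Section FreeProduct.
Variables (k : fieldType) (L1 L2 : LAlgType k) (I J : choiceType).
Variables (x : I -> L1) (y : J -> L2).
Local Notation LXY := (free_lalg k (I + J)%type).

Definition S12 : set LXY := table x inl `|` table y inr.

Definition Sfull (leZ : rel (I + J)%type) : set LXY :=
  S12 `|` completion x inl (Irr leZ S12) `|` completion y inr (Irr leZ S12).

(* The linear maps to [L(X u Y | S_1 u S_2)] sending each basis element to the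
   class of the corresponding generator. *)
Definition inj1 (a : L1) : lquot S12 := lpi S12 (expand x inl a).
Definition inj2 (a : L2) : lquot S12 := lpi S12 (expand y inr a).

End FreeProduct.

(* Main.v *)
Require Import Defs.
From HB Require Import structures.
From mathcomp Require Import all_boot all_algebra finmap.
From mathcomp Require Import boolp classical_sets wochoice.
From mathcomp Require Import monalg.

(** In an L-algebra the left operators [a succ _] commute with the right
    operators [_ prec c]; no other law is imposed.  A normal word is a string of
    left factors, a generator, and a string of right factors,
    [a_1 succ (... (a_m succ (z prec u_1 prec ... prec u_n)))], and the relations
    of the factors only let a generator [a_m] or [u_1] be absorbed into [z], when
    it belongs to the same factor as [z].  Absorbing [a_m] and absorbing [u_1]
    commute, by the law of the factor.  So the coproduct should have as basis the
    words in which no factor can be absorbed, anywhere; they are the words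
    called irreducible below ([irred]).

    Independence.  The space of all words is made an L-algebra [fused_alg] in
    which the product of two words is their formal product, or the result of the
    absorption when one is possible; the law is [fused_succ_precA], where the
    only case with content is [fuse_assoc].  Both factors map to [fused_alg], so
    the coproduct does ([coproduct_map]), and under this map the class of an
    irreducible word is that word itself ([weval_irred]).  Distinct irreducible
    words therefore have linearly independent classes.

    Spanning.  The span of the classes of irreducible words is closed under both
    products ([irred_span_succ], [irred_span_prec]): a product that is not
    irreducible is a [redex], and there the relations of the factor can be
    moved through the right operators ([lsucc_chain]) to express it by
    irreducible words.

    Finally the set [Irr (Sfull x y leZ)] is the set of irreducible normal words
    ([IrrE]).  In each relation of [Sfull] the first term is a word of size
    greater by one than all the others, so it is the leading word
    ([leading_mono_sub]).  These leading words are redexes, and include every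
    redex with irreducible arguments; a reducible word contains one of the latter.

    That the quotient is the coproduct ([lquot_coproduct]) is the universal
    property of the free L-algebra. *)

Set Implicit Arguments.
Unset Strict Implicit.
Unset Printing Implicit Defensive.

Import GRing.Theory.
Local Open Scope ring_scope.

(** * Linear and bilinear extension *)

Section LinearMaps.
Variable k : fieldType.
Implicit Types U V W : lmodType k.

Lemma lin0 U V (f : U -> V) : linear f -> f 0 = 0.
Proof.
by move=> lf; have := lf (-1) 0 0; rewrite scaler0 addr0 scaleN1r addNr.
Qed.

Lemma linB U V (f : U -> V) u v : linear f -> f (u - v) = f u - f v.
Proof. by move=> lf; rewrite addrC -scaleN1r lf scaleN1r addrC. Qed.

Lemma linear_comp U V W (g : V -> W) (f : U -> V) :
  linear g -> linear f -> linear (g \o f).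
Proof. by move=> lg lf a u v /=; rewrite lf lg. Qed.

Definition spans (I : choiceType) V (b : I -> V) : Prop :=
  forall v, exists c, lincomb b c = v.

Lemma linear_ext (I : choiceType) U V (b : I -> U) (f g : U -> V) :
  spans b -> linear f -> linear g -> (forall i, f (b i) = g (b i)) -> f =1 g.
Proof.
move=> sb lf lg fg u; have [c <-] := sb u.
by rewrite !linear_lincomb // (funext fg).
Qed.

Lemma bilinear_ext (I J : choiceType) U V W (b : I -> U) (c : J -> V)
    (f g : U -> V -> W) :
  spans b -> spans c ->
  (forall v, linear (f^~ v)) -> (forall u, linear (f u)) ->
  (forall v, linear (g^~ v)) -> (forall u, linear (g u)) ->
  (forall i j, f (b i) (c j) = g (b i) (c j)) -> f =2 g.
Proof.
move=> sb sc fl fr gl gr fg u v.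
apply: (linear_ext sb (fl v) (gl v)) => i.
exact: (linear_ext sc (fr (b i)) (gr (b i))).
Qed.

Lemma lincomb_malgU (I : choiceType) (c : {malg k[I]}) :
  lincomb (fun i => << i >> : {malg k[I]}) c = c.
Proof.
rewrite [RHS]monalgE; apply: eq_bigr => i _.
apply/malgP => j; rewrite mcoeffZ !mcoeffU.
by case: (i == j); rewrite ?mulr1n ?mulr1 ?mulr0n ?mulr0.
Qed.

Lemma malgU_spans (I : choiceType) :
  spans (fun i => << i >> : {malg k[I]}).
Proof. by move=> c; exists c; exact: lincomb_malgU. Qed.

(** The coefficient of [h i] on the left is the coefficient of [i] in [c]. *)
Lemma lincomb_malgU_inj (I K : choiceType) (h : I -> K) (c : {malg k[I]}) :
  injective h -> lincomb (fun i => << h i >> : {malg k[K]}) c = 0 -> c = 0.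
Proof.
move=> hinj c0; apply/malgP => i; rewrite mcoeff0.
have lcoef : linear (fun f : {malg k[K]} => f@_(h i) : k^o).
  by move=> a f g; rewrite mcoeffD mcoeffZ.
have : (lincomb (fun i => << h i >> : {malg k[K]}) c)@_(h i) = 0.
  by rewrite c0 mcoeff0.
have lci : linear (fun f : {malg k[I]} => f@_i : k^o).
  by move=> a f g; rewrite mcoeffD mcoeffZ.
rewrite (linear_lincomb _ c lcoef) => <-.
rewrite -[in LHS](lincomb_malgU c) (linear_lincomb _ c lci).
by apply: eq_bigr => j _; rewrite !mcoeffU (inj_eq hinj).
Qed.

End LinearMaps.

Section Extend.
Variables (k : fieldType) (I : choiceType) (U : lmodType k) (b : I -> U).
Hypothesis hb : is_basis b.

Let bspan : spans b. Proof. by case: hb. Qed.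

Lemma coordK u : lincomb b (Defs.coord b u) = u.
Proof. exact: (xgetPex 0 (bspan u)). Qed.

Lemma lincombK c : Defs.coord b (lincomb b c) = c.
Proof.
apply/eqP; rewrite -subr_eq0; apply/eqP.
case: hb => free _; apply: free.
by rewrite (linB _ _ (lincomb_linear b)) coordK subrr.
Qed.

Lemma coord_linear : linear (Defs.coord b).
Proof.
by move=> a u v; rewrite -{1}[u]coordK -{1}[v]coordK -lincomb_linear lincombK.
Qed.

Variable V : lmodType k.
Implicit Types h : I -> V.

(** The linear map with prescribed values [h] on the basis [b]. *)
Definition extend h (u : U) : V := lincomb h (Defs.coord b u).

Lemma extend_linear h : linear (extend h).
Proof. by move=> a u v; rewrite /extend coord_linear lincomb_linear. Qed.

Lemma extend_basis h i : extend h (b i) = h i.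
Proof. by rewrite /extend -[b i in LHS](lincombU b) lincombK lincombU. Qed.

Lemma extend_unique h (f : U -> V) :
  linear f -> (forall i, f (b i) = h i) -> f =1 extend h.
Proof.
move=> lf fb; apply: linear_ext bspan lf (extend_linear h) _ => i.
by rewrite fb extend_basis.
Qed.

Lemma linear_extend (W : lmodType k) h (f : V -> W) u :
  linear f -> f (extend h u) = lincomb (f \o h) (Defs.coord b u).
Proof. by move=> lf; rewrite /extend linear_lincomb. Qed.

End Extend.

(** * L-algebra morphisms and evaluation of words *)

Section Products.
Variables (k : fieldType) (A : LAlgType k).

(** The two products as one family, so that an argument that treats them alike
    is made once; [lop] also labels the nodes of a word. *)
Definition lmul (d : lop) : A -> A -> A := if d is Prec then lprec else lsucc.

Lemma lmul_linearr d a : linear (lmul d a).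
Proof. by case: d; [exact: lsucc_linearr | exact: lprec_linearr]. Qed.

Lemma lmul_linearl d a : linear ((lmul d)^~ a).
Proof. by case: d; [exact: lsucc_linearl | exact: lprec_linearl]. Qed.

Fixpoint weval (Z : Type) (g : Z -> A) (w : word Z) : A :=
  match w with
  | Gen z => g z
  | Node d u v => lmul d (weval g u) (weval g v)
  end.

(** The normalizing product [word_prec] moves its right argument down the spine of
    [succ] nodes, which is the L-algebra law in the target. *)
Lemma weval_prec (Z : choiceType) (g : Z -> A) u v :
  weval g (word_prec u v) = lprec (weval g u) (weval g v).
Proof.
elim: u => [//|[] u1 _ u2 IH] //=.
by rewrite /lmul /= IH lsucc_precA.
Qed.

End Products.

Section Homs.
Variable k : fieldType.
Implicit Types A B C : LAlgType k.

Lemma lalg_homP A B (f : A -> B) : lalg_hom f <->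
  linear f /\ forall d a a', f (lmul d a a') = lmul d (f a) (f a').
Proof.
split=> [[lf fp fs]|[lf fm]]; first by split=> // -[].
by split=> // a a'; [exact: (fm Prec) | exact: (fm Succ)].
Qed.

Lemma lalg_hom_comp A B C (g : B -> C) (f : A -> B) :
  lalg_hom g -> lalg_hom f -> lalg_hom (g \o f).
Proof.
move=> /lalg_homP [lg gm] /lalg_homP [lf fm]; apply/lalg_homP; split.
  exact: linear_comp.
by move=> d a a' /=; rewrite fm gm.
Qed.

Lemma weval_hom A B (f : A -> B) (Z : Type) (g : Z -> A) w :
  lalg_hom f -> f (weval g w) = weval (f \o g) w.
Proof.
by move=> /lalg_homP [_ fm]; elim: w => //= d u IHu v IHv; rewrite fm IHu IHv.
Qed.

(** Multiplicativity is a bilinear condition, so a linear map only needs it on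
    a spanning family. *)
Lemma lalg_hom_spans A B (I : choiceType) (b : I -> A) (f : A -> B) :
  spans b -> linear f ->
  (forall d i j, f (lmul d (b i) (b j)) = lmul d (f (b i)) (f (b j))) ->
  lalg_hom f.
Proof.
move=> sb lf fb; apply/lalg_homP; split=> // d.
apply: (bilinear_ext sb sb) (fb d) => a.
- exact: linear_comp lf (lmul_linearl d a).
- exact: linear_comp lf (lmul_linearr d a).
- exact: linear_comp (lmul_linearl d (f a)) lf.
- exact: linear_comp (lmul_linearr d (f a)) lf.
Qed.

(** The case where the products of [b] are again members of [b].  It is stated for
    abstract families, so that concrete monomials, whose conversion is expensive,
    are never compared when it is applied. *)
Lemma lalg_hom_basis A B (I : choiceType) (op : lop -> I -> I -> I)
    (b : I -> A) (c : I -> B) (f : A -> B) :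
  spans b -> linear f ->
  (forall d i j, lmul d (b i) (b j) = b (op d i j)) ->
  (forall i, f (b i) = c i) ->
  (forall d i j, c (op d i j) = lmul d (c i) (c j)) ->
  lalg_hom f.
Proof.
move=> sb lf bM fb cM; apply: lalg_hom_spans sb lf _ => d i j.
by rewrite bM !fb cM.
Qed.

End Homs.

(** * Universal property of the free L-algebra and of its quotients *)

Section Free.
Variables (k : fieldType) (Z : choiceType).
Local Notation LZ := (free_lalg k Z).

Lemma mono_spans : spans (@mono k Z).
Proof. exact: malgU_spans. Qed.

Lemma lsucc_mono (u v : nword Z) : lsucc (mono k u) (mono k v) = mono k (nsucc u v).
Proof. by rewrite /lsucc /= bilinU; exact: lincombU. Qed.

Lemma lprec_mono (u v : nword Z) : lprec (mono k u) (mono k v) = mono k (nprec u v).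
Proof. by rewrite /lprec /= bilinU; exact: lincombU. Qed.

Definition nop (d : lop) : nword Z -> nword Z -> nword Z :=
  if d is Prec then @nprec Z else @nsucc Z.

Lemma lmul_mono d u v : lmul d (mono k u) (mono k v) = mono k (nop d u v).
Proof. by case: d; [exact: lsucc_mono | exact: lprec_mono]. Qed.

(** On normal words of the form [Node Prec u v] the left argument is not a
    [succ] node, so the normalizing product does nothing: every normal word is the
    product in [L(Z)] that it denotes ([mono_weval]). *)
Lemma word_precE (u v : word Z) : ~~ is_succ u -> word_prec u v = Node Prec u v.
Proof. by case: u => // -[]. Qed.

Lemma mono_weval (u : nword Z) :
  mono k u = weval (fun z => mono k (ngen z)) (val u).
Proof.
case: u => w /=; elim: w => [z|d u IHu v IHv] nw /=.
  by congr (mono k _); exact: val_inj.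
case: d nw => nw /=.
  have /= /andP[nu nv] := nw.
  by rewrite -(IHu nu) -(IHv nv) lsucc_mono; congr (mono k _); exact: val_inj.
have /= /and3P[nu nv su] := nw.
rewrite -(IHu nu) -(IHv nv) /lmul lprec_mono; congr (mono k _); apply: val_inj.
change (Node Prec u v = word_prec u v); by rewrite word_precE.
Qed.

Variables (C : LAlgType k) (g : Z -> C).

Lemma weval_nop d (u v : nword Z) :
  weval g (val (nop d u v)) = lmul d (weval g (val u)) (weval g (val v)).
Proof. by case: d; [|exact: weval_prec]. Qed.

Definition free_eval : LZ -> C := lincomb (fun u => weval g (val u)).

Lemma free_eval_mono u : free_eval (mono k u) = weval g (val u).
Proof. exact: (lincombU (fun u => weval g (val u))). Qed.

Lemma free_eval_linear : linear free_eval.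
Proof. exact: lincomb_linear. Qed.

Lemma free_eval_hom : lalg_hom free_eval.
Proof.
exact: lalg_hom_basis mono_spans free_eval_linear lmul_mono
  free_eval_mono weval_nop.
Qed.

Lemma free_eval_unique (h : LZ -> C) :
  lalg_hom h -> (forall z, h (mono k (ngen z)) = g z) -> h =1 free_eval.
Proof.
move=> hh hg; have [lh _] := (lalg_homP h).1 hh.
apply: linear_ext mono_spans lh free_eval_linear _ => u.
by rewrite mono_weval weval_hom // (funext hg : _ \o _ = g) -mono_weval free_eval_mono.
Qed.

End Free.

Section QuotientMaps.
Variables (k : fieldType) (A : LAlgType k) (T : set A).

Lemma lpi_hom : lalg_hom (lpi T).
Proof.
split=> [a x y|x y|x y]; first by rewrite lpiD lpiZ.
  exact/esym/lpi_prec.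
exact/esym/lpi_succ.
Qed.

Lemma ideal_gen_sub x : T x -> ideal_gen T x.
Proof. by move=> Tx N _; apply. Qed.

Lemma kernel_is_ideal (C : LAlgType k) (f : A -> C) :
  lalg_hom f -> is_ideal [set x | f x = 0].
Proof.
case=> lf fp fs; split=> [|a x y /= fx fy|x y /= fx]; first exact: lin0.
  by rewrite lf fx fy scaler0 addr0.
split; rewrite /= ?fp ?fs fx.
- exact: (lin0 (lprec_linearl (f y))).
- exact: (lin0 (lprec_linearr (f y))).
- exact: (lin0 (lsucc_linearl (f y))).
- exact: (lin0 (lsucc_linearr (f y))).
Qed.

Variables (C : LAlgType k) (f : A -> C).
Hypotheses (hf : lalg_hom f) (fT : forall x, T x -> f x = 0).

Definition quot_map (q : lquot T) : C := f (repr q).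

(** The kernel of [f] is an ideal that contains [T], hence contains the difference
    of any two representatives. *)
Lemma quot_map_pi x : quot_map (lpi T x) = f x.
Proof.
have [lf _ _] := hf.
apply/eqP; rewrite -subr_eq0 /quot_map -linB //; apply/eqP.
exact: (ideal_repr (T := T) x (kernel_is_ideal hf) fT).
Qed.

Lemma quot_map_hom : lalg_hom quot_map.
Proof.
have [lp pp ps] := lpi_hom; have [lf fp fs] := hf.
split=> [a|p|p] q; rewrite -[q]lpi_reprK.
- by move=> r; rewrite -[r]lpi_reprK -lp !quot_map_pi lf.
- by rewrite -[p]lpi_reprK -pp !quot_map_pi fp.
- by rewrite -[p]lpi_reprK -ps !quot_map_pi fs.
Qed.

End QuotientMaps.

(** * The quotient by the multiplication tables is the coproduct *)

(** Each statement about one factor is proved for an arbitrary algebra [L] whose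
    basis [b] is embedded by [inc] in the generators, and then used for both
    factors. *)
Section Factor.
Variables (k : fieldType) (L : LAlgType k) (I Z : choiceType).
Variables (b : I -> L) (inc : I -> Z).
Hypothesis hb : is_basis b.
Local Notation LZ := (free_lalg k Z).

Let bspan : spans b. Proof. by case: hb. Qed.

Lemma expand_linear : linear (expand b inc).
Proof. exact: (extend_linear hb (gen k inc)). Qed.

Lemma expand_basis i : expand b inc (b i) = gen k inc i.
Proof. exact: (extend_basis hb (gen k inc)). Qed.

Lemma tableP s : table b inc s <-> exists d i j,
  s = lmul d (gen k inc i) (gen k inc j) - expand b inc (lmul d (b i) (b j)).
Proof.
split=> [[i [j []->]]|[[] [i [j ->]]]].
- by exists Prec, i, j.
- by exists Succ, i, j.
- by exists i, j; right.
- by exists i, j; left.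
Qed.

Section Eval.
Variables (C : LAlgType k) (g : Z -> C) (f : L -> C).
Hypotheses (hf : lalg_hom f) (gf : forall i, g (inc i) = f (b i)).

Lemma free_eval_gen i : free_eval g (gen k inc i) = f (b i).
Proof. by rewrite free_eval_mono -gf. Qed.

Lemma free_eval_expand a : free_eval g (expand b inc a) = f a.
Proof.
have [lf _ _] := hf; move: a.
apply: linear_ext bspan (linear_comp (free_eval_linear g) expand_linear) lf _ => i.
by rewrite /= expand_basis free_eval_gen.
Qed.

Lemma free_eval_table s : table b inc s -> free_eval g s = 0.
Proof.
have [lf fm] := (lalg_homP f).1 hf.
have [le em] := (lalg_homP _).1 (free_eval_hom g).
move=> /tableP [d [i [j ->]]].
have := free_eval_expand (lmul d (b i) (b j)).
move: (free_eval_gen i) (free_eval_gen j); move: (gen k inc i) (gen k inc j).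
by move: (expand b inc _) => e u v Eu Ev Ee; rewrite linB // em Eu Ev Ee fm subrr.
Qed.

End Eval.

Variable T : set LZ.
Hypothesis tableT : forall s, table b inc s -> T s.

(** The relations of the table are what makes this linear map multiplicative on
    the basis, hence everywhere. *)
Lemma lpi_expand_hom : lalg_hom (lpi T \o expand b inc).
Proof.
have [lp pm] := (lalg_homP _).1 (lpi_hom T).
apply: lalg_hom_spans bspan _ _ => [|d i j]; first exact: linear_comp expand_linear.
have Tij : T (lmul d (gen k inc i) (gen k inc j)
              - expand b inc (lmul d (b i) (b j))).
  by apply/tableT/tableP; exists d, i, j.
rewrite /= (expand_basis i) (expand_basis j) -pm.
exact: esym ((lpi_eq _ _ _).2 (ideal_gen_sub Tij)).
Qed.

End Factor.

Section Coproduct.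
Variables (k : fieldType) (L1 L2 : LAlgType k) (I J : choiceType).
Variables (x : I -> L1) (y : J -> L2).
Hypotheses (hx : is_basis x) (hy : is_basis y).
Local Notation Z := (I + J)%type.
Local Notation LXY := (free_lalg k Z).
Local Notation Q := (lquot (S12 x y)).

Lemma inj1_hom : lalg_hom (inj1 x y).
Proof. by apply: lpi_expand_hom => // s; left. Qed.

Lemma inj2_hom : lalg_hom (inj2 x y).
Proof. by apply: lpi_expand_hom => // s; right. Qed.

Lemma inj1_basis i : inj1 x y (x i) = lpi (S12 x y) (mono k (ngen (inl i))).
Proof. by rewrite /inj1 expand_basis. Qed.

Lemma inj2_basis j : inj2 x y (y j) = lpi (S12 x y) (mono k (ngen (inr j))).
Proof. by rewrite /inj2 expand_basis. Qed.

Definition copair (T : Type) (f : L1 -> T) (g : L2 -> T) (z : Z) : T :=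
  match z with inl i => f (x i) | inr j => g (y j) end.

Lemma lpi_mono_weval (u : nword Z) :
  lpi (S12 x y) (mono k u) = weval (copair (inj1 x y) (inj2 x y)) (val u).
Proof.
rewrite mono_weval (weval_hom _ _ (lpi_hom _)).
by congr weval; apply/funext => -[i|j] /=; rewrite ?inj1_basis ?inj2_basis.
Qed.

Section Universal.
Variables (C : LAlgType k) (f : L1 -> C) (g : L2 -> C).
Hypotheses (hf : lalg_hom f) (hg : lalg_hom g).

Let ev : LXY -> C := free_eval (copair f g).

Let evS s : S12 x y s -> ev s = 0.
Proof.
by case=> [/(free_eval_table hx)|/(free_eval_table hy)] E;
  [apply: (E C _ f) | apply: (E C _ g)].
Qed.

Lemma coproduct_map : exists h : Q -> C,
  [/\ lalg_hom h, h \o inj1 x y = f & h \o inj2 x y = g].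
Proof.
have hev : lalg_hom ev := free_eval_hom _.
exists (quot_map ev); split; first exact: quot_map_hom.
  by apply/funext => a; rewrite /= quot_map_pi //; apply: free_eval_expand.
by apply/funext => a; rewrite /= quot_map_pi //; apply: free_eval_expand.
Qed.

(** A morphism out of the quotient is fixed by the classes of the generators, which
    are the images of the two bases. *)
Lemma coproduct_map_unique (h : Q -> C) :
  lalg_hom h -> h \o inj1 x y = f -> h \o inj2 x y = g ->
  forall s, h (lpi _ s) = ev s.
Proof.
move=> hh h1 h2; apply: free_eval_unique => [|[i|j]].
- exact: lalg_hom_comp hh (lpi_hom _).
- by rewrite /= -inj1_basis -h1.
- by rewrite /= -inj2_basis -h2.
Qed.

End Universal.

Lemma lquot_coproduct : is_coproduct (inj1 x y) (inj2 x y).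
Proof.
split=> [||C f g hf hg]; [exact: inj1_hom | exact: inj2_hom |].
have [h [hh h1 h2]] := coproduct_map hf hg.
exists h; split=> // h' [hh' h1' h2']; apply/funext => q.
rewrite -[q]lpi_reprK (coproduct_map_unique hh h1 h2).
by rewrite (coproduct_map_unique hh' h1' h2').
Qed.

End Coproduct.

(** * Irreducible words *)

Section Words.
Variable Z : Type.
Implicit Types u v w : word Z.

(** [head w] is the generator [z] when [w] is a chain
    [z prec u_1 prec ... prec u_n], and [rehead] replaces it.  A word whose outer
    node is [succ] has no head: the left factors it already has separate
    its innermost generator from any further one. *)
Fixpoint head w : option Z :=
  match w with
  | Gen z => Some z
  | Node Prec u _ => head u
  | Node Succ _ _ => None
  end.

Fixpoint rehead w (z : Z) : word Z :=
  match w with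
  | Gen _ => Gen z
  | Node Prec u v => Node Prec (rehead u z) v
  | Node Succ _ _ => w
  end.

Lemma rehead_head w z : head w = Some z -> rehead w z = w.
Proof. by elim: w => [a [->]|[] u IHu v _] //= /IHu ->. Qed.

Lemma normal_rehead w z : normal (rehead w z) = normal w.
Proof.
have succ_rehead u : is_succ (rehead u z) = is_succ u by case: u => // -[].
by elim: w => [//|[] u IHu v _] //=; rewrite IHu succ_rehead.
Qed.

End Words.

Lemma normal_node (Z : Type) d (u v : word Z) :
  normal (Node d u v) -> normal u && normal v.
Proof. by case: d => //= /and3P[-> ->]. Qed.

Section Irreducible.
Variables I J : Type.
Local Notation Z := (I + J)%type.
Implicit Types (p q z : Z) (u v w : word Z).

Definition side p : bool := if p is inl _ then true else false.

(** The products in which one argument is a generator that can be absorbed into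
    the other.  A left factor is absorbed by any chain.  A right factor is absorbed
    only by a bare generator: in a longer chain it comes after the other right
    factors, and the left argument of [prec] in a normal word is not a [succ]
    node. *)
Definition redex (d : lop) u v : bool :=
  match d with
  | Succ => if (u, head v) is (Gen p, Some q) then side p == side q else false
  | Prec => if (u, v) is (Gen p, Gen q) then side p == side q else false
  end.

Fixpoint irred w : bool :=
  match w with
  | Gen _ => true
  | Node d u v => [&& irred u, irred v & ~~ redex d u v]
  end.

(** Being a redex depends only on the factor to which the head belongs. *)
Lemma irred_rehead w z q :
  head w = Some q -> side q = side z -> irred w -> irred (rehead w z).
Proof.
move=> hq qz; elim: w hq => [//|[] u IHu v _] //= hu /and3P[iu -> nr] /=.
rewrite IHu //=; apply: contra nr.
by case: u hu {IHu iu} => [a [->]|[]] //; case: v => // b /=; rewrite qz.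
Qed.

End Irreducible.

(** * An L-algebra on the space of all words *)

(** A sealed copy of the monomial: unfolding monomials in conversion tests is very
    costly. *)
HB.lock Definition point (k : fieldType) (I : choiceType) (i : I) :
  {malg k[I]} := << i >>.

Section Point.
Variables (k : fieldType) (I : choiceType) (V : lmodType k).

Lemma lincomb_point (h : I -> V) i : lincomb h (point k i) = h i.
Proof. by rewrite point.unlock lincombU. Qed.

Lemma point_spans : spans (point k (I := I)).
Proof. by rewrite point.unlock; exact: malgU_spans. Qed.

End Point.

(** Expanding [(a succ a') prec c] by two successive absorptions, in either order,
    gives the same result: both sides are [h] extended to the two sides of the law
    of [A]. *)
Lemma extend_assoc (k : fieldType) (A : LAlgType k) (K : choiceType)
    (V : lmodType k) (b : K -> A) (h : K -> V) (a a' c : A) :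
  is_basis b ->
  extend b (fun l => extend b h (lprec (b l) c)) (lsucc a a')
  = extend b (fun l => extend b h (lsucc a (b l))) (lprec a' c).
Proof.
move=> hb; have lh := extend_linear hb h.
rewrite -(extend_unique hb (linear_comp lh (lprec_linearl c))) //.
rewrite -(extend_unique hb (linear_comp lh (lsucc_linearr a))) //.
by rewrite /= lsucc_precA.
Qed.

Section Fuse.
Variables (k : fieldType) (L1 L2 : LAlgType k) (I J : choiceType).
Variables (x : I -> L1) (y : J -> L2).
Hypotheses (hx : is_basis x) (hy : is_basis y).
Local Notation Z := (I + J)%type.
Implicit Types (V : lmodType k) (p q r z : Z).

(** The linear combination of the values [h z] with coefficients those of the
    product of the basis elements [p] and [q], when these lie in the same factor;
    the value [dflt] stands for the formal product otherwise. *)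
Definition fuse V d (h : Z -> V) (dflt : V) p q : V :=
  match p, q with
  | inl i, inl i' => extend x (h \o inl) (lmul d (x i) (x i'))
  | inr j, inr j' => extend y (h \o inr) (lmul d (y j) (y j'))
  | _, _ => dflt
  end.

Lemma fuse_dflt V d (h : Z -> V) e p q : side p != side q -> fuse d h e p q = e.
Proof. by case: p q => [i|j] [i'|j']. Qed.

(** Only the values of [h] at generators of the common factor matter. *)
Lemma eq_fuse V d (h h' : Z -> V) e e' p q :
  side p = side q -> (forall z, side q = side z -> h z = h' z) ->
  fuse d h e p q = fuse d h' e' p q.
Proof.
case: p q => [i|j] [i'|j'] //= _ hh'; congr (lincomb _ _);
  by apply/funext => l; apply: hh'.
Qed.

Lemma linear_fuse V (W : lmodType k) (f : V -> W) d (h : Z -> V) e p q :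
  linear f -> f (fuse d h e p q) = fuse d (f \o h) (f e) p q.
Proof. by move=> lf; case: p q => [i|j] [i'|j'] //=; exact: linear_extend. Qed.

Lemma fuse_assoc V (h : Z -> V) (e1 e2 e3 e4 : V) p q r :
  side p = side q -> side q = side r ->
  fuse Succ (fun z => fuse Prec h e1 z r) e2 p q
  = fuse Prec (fun z => fuse Succ h e3 p z) e4 q r.
Proof.
by case: p q r => [i|j] [i'|j'] [i''|j''] // _ _; apply: extend_assoc.
Qed.

End Fuse.

Section WordOps.
Variables (k : fieldType) (L1 L2 : LAlgType k) (I J : choiceType).
Variables (x : I -> L1) (y : J -> L2).
Hypotheses (hx : is_basis x) (hy : is_basis y).
Local Notation Z := (I + J)%type.
Local Notation KW := {malg k[word Z]}.
Implicit Types (u v w : word Z) (f g h : KW).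

(** A left generator is absorbed by the head of a chain, which keeps its right
    factors. *)
Definition fused_succ u v : KW :=
  match u, head v with
  | Gen p, Some q =>
      fuse x y Succ (fun z => point k (rehead v z)) (point k (Node Succ u v)) p q
  | _, _ => point k (Node Succ u v)
  end.

(** The clause for [u1 succ u2] uses [fused_succ], and not the formal product, so
    that the law of L-algebras holds by definition except when [fused_succ] has
    absorbed its left argument. *)
Fixpoint fused_prec u v : KW :=
  match u, v with
  | Node Succ u1 u2, _ => lincomb (fused_succ u1) (fused_prec u2 v)
  | Gen p, Gen q =>
      fuse x y Prec (fun z => point k (Gen z)) (point k (Node Prec u v)) p q
  | _, _ => point k (Node Prec u v)
  end.

Definition fused_op d := if d is Prec then fused_prec else fused_succ.

Lemma fused_op_irred d u v : normal (Node d u v) -> ~~ redex d u v ->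
  fused_op d u v = point k (Node d u v).
Proof.
case: d => /=.
  move=> _; rewrite /fused_succ; case: u => // p.
  by case: (head v) => // q pq; apply: fuse_dflt.
case/and3P=> _ _; case: u => [p|[]] //= _.
by case: v => // q pq; apply: fuse_dflt.
Qed.

(** The law on words.  It holds by definition if [u succ v] is a formal product.
    Otherwise [u] is a generator and [v] a chain with a head in the same factor; if
    [w] only lengthens this chain, the head is not affected and both sides agree
    term by term; if [v] is itself a generator that absorbs [w], this is the law of
    the factor. *)
Lemma fused_succ_precA u v w :
  lincomb (fused_prec ^~ w) (fused_succ u v)
  = lincomb (fused_succ u) (fused_prec v w).
Proof.
have plain : fused_succ u v = point k (Node Succ u v) ->
    lincomb (fused_prec ^~ w) (fused_succ u v)
    = lincomb (fused_succ u) (fused_prec v w).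
  by move=> ->; rewrite lincomb_point.
case Eu: u plain => [p|d u1 u2] plain; last by apply: plain.
case Ev: (head v) => [q|]; last by apply: plain; rewrite /fused_succ Ev.
have [pq|pq] := eqVneq (side p) (side q); last first.
  by apply: plain; rewrite /fused_succ Ev fuse_dflt.
rewrite {1}/fused_succ Ev (linear_fuse _ _ _ _ _ _ _ (lincomb_linear _)).
(* The case where [w] lengthens the chain, for every choice of its head. *)
have chain : (forall z, side q = side z ->
      fused_prec (rehead v z) w = point k (Node Prec (rehead v z) w)) ->
    fuse x y Succ
      (lincomb (fused_prec ^~ w) \o (fun z => point k (rehead v z)))
      (lincomb (fused_prec ^~ w) (point k (Node Succ (Gen p) v))) p q
    = lincomb (fused_succ (Gen p)) (fused_prec v w).
  move=> vw; have := vw q erefl; rewrite (rehead_head Ev) => ->.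
  rewrite [RHS]lincomb_point [RHS]/fused_succ /= Ev.
  apply: eq_fuse pq _ => z qz.
  exact: etrans (lincomb_point (fused_prec ^~ w) (rehead v z)) (vw z qz).
case: v Ev {plain} chain => [q'|[] v1 v2] //= Ev chain; last first.
  by apply: chain => z _; case: v1 Ev => // -[].
case: Ev chain => -> chain.
case: w chain => [r|d w1 w2] chain; last exact: chain.
have [qr|qr] := eqVneq (side q) (side r); last first.
  by apply: chain => z qz; rewrite fuse_dflt // -qz.
rewrite (linear_fuse _ _ _ _ _ _ _ (lincomb_linear _)).
(* An arbitrary default value, as [p], [q] and [r] lie in one factor. *)
pose e := point k (Gen q).
rewrite (eq_fuse x y Succ
  (h' := fun z => fuse x y Prec (fun z => point k (Gen z)) e z r) _ e pq); last first.
  move=> z qz; apply: etrans (lincomb_point _ _) _.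
  by apply: eq_fuse => [|//]; rewrite -qz.
rewrite [RHS](eq_fuse x y Prec
  (h' := fun z => fuse x y Succ (fun z => point k (Gen z)) e p z) _ e qr); last first.
  move=> z rz; apply: etrans (lincomb_point _ _) _.
  by apply: eq_fuse => [|//]; rewrite -rz -qr.
exact: fuse_assoc.
Qed.

Definition word_bilin (op : word Z -> word Z -> KW) f g : KW :=
  lincomb (fun u => lincomb (op u) g) f.

Lemma word_bilin_linearr op f : linear (word_bilin op f).
Proof.
move=> a g h; apply: etrans (lincombDx _ _ a f); congr (lincomb _ f).
by apply/funext => u; apply: lincomb_linear.
Qed.

Lemma word_bilin_linearl op g : linear (word_bilin op ^~ g).
Proof. by move=> a f h; apply: lincomb_linear. Qed.

Lemma word_bilin_point op u v :
  word_bilin op (point k u) (point k v) = op u v.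
Proof. by rewrite /word_bilin !lincomb_point. Qed.

Lemma fused_bilin_precA f g h :
  word_bilin fused_prec (word_bilin fused_succ f g) h
  = word_bilin fused_succ f (word_bilin fused_prec g h).
Proof.
pose P := word_bilin fused_prec; pose S := word_bilin fused_succ.
have Pr := word_bilin_linearr fused_prec; have Pl := word_bilin_linearl fused_prec.
have Sr := word_bilin_linearr fused_succ; have Sl := word_bilin_linearl fused_succ.
have sp := @point_spans k (word Z).
apply: (linear_ext sp (linear_comp (Pl h) (Sl g)) (Sl (P g h))) => u /=.
apply: (linear_ext sp (linear_comp (Pl h) (Sr _)) (linear_comp (Sr _) (Pl h))) => v /=.
apply: (linear_ext sp (Pr _) (linear_comp (Sr _) (Pr _))) => w /=.
apply: etrans (congr1 (P ^~ _) (word_bilin_point fused_succ u v)) _.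
apply: etrans _ (congr1 (S _) (esym (word_bilin_point fused_prec v w))).
apply: etrans _ (esym (lincomb_point _ u)); rewrite -fused_succ_precA.
by apply: (congr1 (fun F => lincomb F _)); apply/funext => t; rewrite lincomb_point.
Qed.

(** The proofs that [x] and [y] are bases are parameters of the type because the
    instance of L-algebra below depends on them. *)
Definition fused_alg of is_basis x & is_basis y : Type := KW.

HB.instance Definition _ := GRing.Lmodule.on (fused_alg hx hy).

HB.instance Definition _ := Lmodule_isLAlg.Build k (fused_alg hx hy)
  (word_bilin_linearr fused_prec) (word_bilin_linearl fused_prec)
  (word_bilin_linearr fused_succ) (word_bilin_linearl fused_succ)
  fused_bilin_precA.

Local Notation W := (fused_alg hx hy : LAlgType k).

Definition wpoint u : W := point k u.

Lemma lmul_wpoint d u v : lmul d (wpoint u) (wpoint v) = fused_op d u v :> W.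
Proof. by case: d; apply: word_bilin_point. Qed.

Definition fused_inj1 : L1 -> W := extend x (fun i => wpoint (Gen (inl i))).
Definition fused_inj2 : L2 -> W := extend y (fun j => wpoint (Gen (inr j))).

Lemma fused_inj1_hom : lalg_hom fused_inj1.
Proof.
have [_ sx] := hx; apply: lalg_hom_spans sx (extend_linear hx _) _ => d i i'.
by rewrite /fused_inj1 !(extend_basis hx) lmul_wpoint; case: d.
Qed.

Lemma fused_inj2_hom : lalg_hom fused_inj2.
Proof.
have [_ sy] := hy; apply: lalg_hom_spans sy (extend_linear hy _) _ => d j j'.
by rewrite /fused_inj2 !(extend_basis hy) lmul_wpoint; case: d.
Qed.

(** In [fused_alg] no product of an irreducible word is absorbed, so the value of
    the word is the word. *)
Lemma weval_irred w : normal w -> irred w ->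
  weval (copair x y fused_inj1 fused_inj2) w = wpoint w.
Proof.
elim: w => [[i|j] _ _|d u IHu v IHv nw /= /and3P[iu iv nr]] /=.
- exact: extend_basis.
- exact: extend_basis.
have /andP[nu nv] := normal_node nw.
by rewrite (IHu nu iu) (IHv nv iv) lmul_wpoint; apply: fused_op_irred.
Qed.

End WordOps.

(** * Irreducible words span the coproduct *)

Section Subspaces.
Variables (k : fieldType) (V : lmodType k).

Definition subspace (N : V -> Prop) : Prop :=
  N 0 /\ forall a u v, N u -> N v -> N (a *: u + v).

Lemma subspace_lincomb (I : choiceType) N (h : I -> V) (c : {malg k[I]}) :
  subspace N -> (forall i, i \in msupp c -> N (h i)) -> N (lincomb h c).
Proof.
move=> [N0 ND] Nh; rewrite /lincomb big_seq.
by elim/big_rec: _ => // i v /Nh Ni; apply: ND.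
Qed.

Lemma subspace_range (I : choiceType) (b : I -> V) :
  subspace (fun v => exists c, lincomb b c = v).
Proof.
split=> [|a _ _ [c <-] [d <-]]; first by exists 0; exact: lin0 (lincomb_linear b).
by exists (a *: c + d); exact: lincomb_linear.
Qed.

End Subspaces.

Lemma subspace_preim (k : fieldType) (U V : lmodType k) (N : V -> Prop) (f : U -> V) :
  subspace N -> linear f -> subspace (N \o f).
Proof.
move=> [N0 ND] lf; split=> [|a u v Nu Nv] /=; first by rewrite (lin0 lf).
by rewrite lf; apply: ND.
Qed.

Section FactorChain.
Variables (k : fieldType) (L C : LAlgType k) (I Z : choiceType).
Variables (b : I -> L) (inc : I -> Z) (g : Z -> C) (f : L -> C).
Hypotheses (hb : is_basis b) (hf : lalg_hom f) (gf : forall i, g (inc i) = f (b i)).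

(** A redex is the combination of the chains obtained from the product of the two
    generators.  Replacing the head by an arbitrary element [a] of [L] makes the
    chain a linear function [E v a], and the right operators commute with the left
    multiplication by [f (b i)], so the formula holds since it does for the chain
    without right factors.  This is what the relations [completion] express. *)
Lemma lsucc_chain (v : word Z) i j : head v = Some (inc j) ->
  lsucc (f (b i)) (weval g v)
  = extend b (fun l => weval g (rehead v (inc l))) (lsucc (b i) (b j)).
Proof.
pose E v := extend b (fun l => weval g (rehead v (inc l))).
have [lf fp fs] := hf.
move=> hv; have E_b : E v (b j) = weval g v.
  by rewrite /E extend_basis // rehead_head.
rewrite -E_b -/(E v _); move: (b j) => a {E_b}.
elim: v hv => [z _|[] u IHu v _] //=.
  have Ef : E (Gen z) =1 f.
    by move=> c; apply/esym/(extend_unique hb lf) => l; rewrite /= gf.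
  by rewrite !Ef fs.
move=> /IHu hu; have Eu c : E (Node Prec u v) c = lprec (E u c) (weval g v).
  have lE := linear_comp (lprec_linearl (weval g v))
    (extend_linear hb (fun l => weval g (rehead u (inc l)))).
  by apply/esym/(extend_unique hb lE) => l; rewrite /= extend_basis.
by rewrite !Eu -lsucc_precA hu.
Qed.

End FactorChain.

Section Span.
Variables (k : fieldType) (L1 L2 C : LAlgType k) (I J : choiceType).
Variables (x : I -> L1) (y : J -> L2) (f : L1 -> C) (g : L2 -> C).
Hypotheses (hx : is_basis x) (hy : is_basis y).
Hypotheses (hf : lalg_hom f) (hg : lalg_hom g).
Local Notation Z := (I + J)%type.
Local Notation ev := (weval (copair x y f g)).
Implicit Types (u v w : word Z).

(** The span as an intersection of subspaces: closure properties are then proved by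
    taking for [N] the preimage of the span under a linear map. *)
Definition irred_span (a : C) : Prop := forall N : C -> Prop, subspace N ->
  (forall w, normal w -> irred w -> N (ev w)) -> N a.

Lemma irred_span_subspace : subspace irred_span.
Proof.
split=> [N [] //|a u v Su Sv N sN Nw].
by have [_ ND] := sN; apply: ND; [exact: Su | exact: Sv].
Qed.

Lemma irred_span_ev w : normal w -> irred w -> irred_span (ev w).
Proof. by move=> nw iw N _; apply. Qed.

Lemma irred_span_linear (h : C -> C) : linear h ->
  (forall w, normal w -> irred w -> irred_span (h (ev w))) ->
  forall a, irred_span a -> irred_span (h a).
Proof.
move=> lh hw a Sa; exact: Sa (subspace_preim irred_span_subspace lh) hw.
Qed.

Lemma irred_span_succ u v : normal u -> irred u -> normal v -> irred v ->
  irred_span (lsucc (ev u) (ev v)).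
Proof.
move=> nu iu nv iv.
have [ruv|ruv] := boolP (redex Succ u v); last first.
  by apply: (irred_span_ev (w := Node Succ u v)) => /=; rewrite ?nu ?iu ?iv.
case: u ruv {nu iu} => // p /=; case Ev: (head v) => [q|//] /eqP pq.
have Sv z : side q = side z -> irred_span (ev (rehead v z)).
  by move=> qz; apply: irred_span_ev; rewrite ?normal_rehead ?(irred_rehead Ev).
case: p q pq Ev Sv => [i|j] [i'|j'] //= _ Ev Sv.
- rewrite (lsucc_chain (inc := inl) hx hf _ _ Ev) //.
  apply: subspace_lincomb irred_span_subspace _ => l _; exact: Sv.
- rewrite (lsucc_chain (inc := inr) hy hg _ _ Ev) //.
  apply: subspace_lincomb irred_span_subspace _ => l _; exact: Sv.
Qed.

(** By the L-algebra law the right factor moves down the spine of [succ] nodes of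
    [u], to a chain that it lengthens or a generator that absorbs it. *)
Lemma irred_span_prec u v : normal u -> irred u -> normal v -> irred v ->
  irred_span (lprec (ev u) (ev v)).
Proof.
move=> nu iu nv iv; elim: u nu iu => [p|d u1 _ u2 IH] nu iu.
  have [ruv|ruv] := boolP (redex Prec (Gen p) v); last first.
    by apply: (irred_span_ev (w := Node Prec (Gen p) v)) => /=; rewrite ?nv ?iv.
  case: v ruv {nv iv} => // q /= /eqP.
  have Sg z : irred_span (copair x y f g z).
    exact: (irred_span_ev (w := Gen z)).
  have [[lf fp _] [lg gp _]] := (hf, hg).
  case: p q {nu iu} => [i|j] [i'|j'] //= _.
  - rewrite -fp (extend_unique hx lf (h := fun i => f (x i))) //.
    apply: subspace_lincomb irred_span_subspace _ => l _; exact: (Sg (inl l)).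
  - rewrite -gp (extend_unique hy lg (h := fun j => g (y j))) //.
    apply: subspace_lincomb irred_span_subspace _ => l _; exact: (Sg (inr l)).
have /= /and3P[iu1 iu2 _] := iu; case: d nu iu => nu iu.
  have /= /andP[nu1 nu2] := nu.
  rewrite /= lsucc_precA; apply: irred_span_linear (IH nu2 iu2).
    exact: lsucc_linearr.
  by move=> w; apply: irred_span_succ.
by apply: (irred_span_ev (w := Node Prec (Node Prec u1 u2) v)) => //;
  apply/and3P; split.
Qed.

Lemma irred_span_word w : irred_span (ev w).
Proof.
elim: w => [z|d u IHu v IHv]; first exact: (irred_span_ev (w := Gen z)).
rewrite /=; move: IHu; move: (ev u); apply: irred_span_linear.
  exact: (lmul_linearl d (ev v)).
move=> u' nu iu; move: IHv; apply: irred_span_linear; first exact: lmul_linearr.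
by case: d => w nw iw; [exact: irred_span_succ | exact: irred_span_prec].
Qed.

End Span.

(** * The irreducible words of the completed relations *)

Section Occurrences.
Variable Z : Type.
Implicit Types u v w : word Z.

Fixpoint wlift w : word (option Z) :=
  match w with Gen z => Gen (Some z) | Node d u v => Node d (wlift u) (wlift v) end.

Lemma nstars_wlift w : nstars (wlift w) = 0%N.
Proof. by elim: w => //= d u -> v ->. Qed.

Lemma wsubst_wlift w s : wsubst (wlift w) s = w.
Proof. by elim: w => //= d u -> v ->. Qed.

End Occurrences.

Definition nchain (Z : choiceType) (w : nword Z) (vs : seq (nword Z)) : nword Z :=
  foldl (@nprec Z) w vs.

Section IrredOccurrences.
Variables I J : choiceType.
Local Notation Z := (I + J)%type.
Implicit Types (u v w s : word Z) (t : word (option Z)).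

Lemma irred_wsubst t s : star_word t -> irred (wsubst t s) -> irred s.
Proof.
elim: t => [[]|d u IHu v IHv] //=; rewrite /star_word /= => uv /and3P[iu iv _].
case Eu: (nstars u) uv => [|[|n]] // uv; first exact: IHv.
exact: IHu.
Qed.

(** A reducible word contains a minimal redex, one with irreducible arguments. *)
Lemma reducible_occurrence w : normal w -> ~~ irred w -> exists t d u v,
  [/\ star_word t, w = wsubst t (Node d u v), normal (Node d u v),
      irred u && irred v & redex d u v].
Proof.
elim: w => [//|d u IHu v IHv] nw; have /andP[nu nv] := normal_node nw.
have [iu|/(IHu nu) [t [e [u1 [u2 [st Eu nE iE rE]]]]] _] := boolP (irred u); last first.
  exists (Node d t (wlift v)), e, u1, u2; split=> //.
    by rewrite /star_word /= nstars_wlift addn0.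
  by rewrite /= wsubst_wlift -Eu.
have [iv|/(IHv nv) [t [e [v1 [v2 [st Ev nE iE rE]]]]] _] := boolP (irred v); last first.
  exists (Node d (wlift u) t), e, v1, v2; split=> //.
    by rewrite /star_word /= nstars_wlift.
  by rewrite /= wsubst_wlift -Ev.
rewrite /= iu iv negbK => ruv.
by exists (Gen None), d, u, v; split=> //; rewrite iu iv.
Qed.

Lemma head_word_prec u v z : head u = Some z -> head (word_prec u v) = Some z.
Proof. by case: u => // -[]. Qed.

Lemma irred_word_prec u v : irred (word_prec u v) -> irred u.
Proof.
elim: u => [//|[] u1 IH1 u2 IH2] /=; last by case/and3P.
case/and3P=> -> /IH2 ->; apply: contra.
case: u1 {IH1} => // p; case E: (head u2) => [q|//].
by rewrite (head_word_prec _ E).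
Qed.

Lemma irred_nchain (w : nword Z) vs : irred (val (nchain w vs)) -> irred (val w).
Proof. by elim: vs w => [//|v vs IH] w /IH; apply: irred_word_prec. Qed.

Lemma head_nchain (w : nword Z) vs z :
  head (val w) = Some z -> head (val (nchain w vs)) = Some z.
Proof.
by elim: vs w => [//|v vs IH] w hw; apply: IH; apply: head_word_prec.
Qed.

(** The right factors of an irreducible chain, which have to be irreducible for the
    chain to give a relation of [completion]. *)
Lemma nchain_of_head w z : normal w -> irred w -> head w = Some z ->
  exists2 vs : seq (nword Z), w = val (nchain (ngen z) vs)
    & forall v : nword Z, v \in vs -> irred (val v).
Proof.
elim: w => [a _ _ [->]|[] u IHu v _] //=; first by exists [::].
move=> /and3P[nu nv su] /and3P[iu iv _] /(IHu nu iu) [vs Eu ivs].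
exists (rcons vs (exist _ v nv)) => [|v'].
  rewrite /nchain foldl_rcons.
  change (Node Prec u v = word_prec (val (nchain (ngen z) vs)) v).
  by rewrite -Eu word_precE.
by rewrite mem_rcons inE => /orP[/eqP->|/ivs].
Qed.

End IrredOccurrences.

Lemma val_nprec (Z : choiceType) (u v : nword Z) :
  val (nprec u v) = word_prec (val u) (val v).
Proof. by []. Qed.

Section Leading.
Variables (k : fieldType) (Z : choiceType) (leZ : rel Z).
Local Notation LZ := (free_lalg k Z).
Implicit Types (u v w : nword Z) (f g r : LZ).

Lemma word_lt_size (u v : word Z) : (wsize u < wsize v)%N -> word_lt leZ u v.
Proof. by case: u v => [a|d u1 u2] [b|e v1 v2] //= ->. Qed.

Lemma word_lt_leq_size (u v : word Z) : word_lt leZ u v -> (wsize u <= wsize v)%N.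
Proof.
by case: u v => [a|d u1 u2] [b|e v1 v2] /orP[/ltnW //|/andP[/eqP -> _]].
Qed.

(** Sizes alone determine the leading words of the relations, since
    size is the first component of the weight. *)
Definition sized n f : Prop := forall w, w \in msupp f -> wsize (val w) = n.

Lemma sized_subspace n : subspace (sized n).
Proof.
split=> [w|a f g sf sg w]; first by rewrite msupp0.
move/(fsubsetP (msuppD_le _ _)); rewrite inE => /orP[|/sg //].
by move/(fsubsetP (msuppZ_le _ _))/sf.
Qed.

Lemma sized_mono w : sized (wsize (val w)) (mono k w).
Proof. by move=> v /(fsubsetP msuppU_le); rewrite inE => /eqP ->. Qed.

Arguments sized_mono w : clear implicits.

Lemma wsize_prec (u v : word Z) : wsize (word_prec u v) = (wsize u + wsize v)%N.
Proof. by elim: u => [//|[] u1 _ u2 IH] //=; rewrite IH addnA. Qed.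

Lemma sized_prec m n f g : sized m f -> sized n g -> sized (m + n) (lprec f g).
Proof.
move=> sf sg; apply: subspace_lincomb (sized_subspace _) _ => u /sf <-.
apply: subspace_lincomb (sized_subspace _) _ => v /sg <-.
rewrite -wsize_prec -val_nprec; exact: sized_mono.
Qed.

Lemma sized_prec_chain n f (vs : seq (nword Z)) : sized n f ->
  sized (n + sumn [seq wsize (val v) | v <- vs]) (prec_chain f vs).
Proof.
elim: vs n f => [|v vs IH] n f sf; first by rewrite addn0.
rewrite [X in sized X]/= addnA; exact: IH (@sized_prec _ _ _ _ sf (sized_mono v)).
Qed.

Lemma sized_expand (L : LAlgType k) (I : choiceType) (b : I -> L) (inc : I -> Z) a :
  sized 1 (expand b inc a).
Proof.
apply: subspace_lincomb (sized_subspace _) _ => i _.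
exact: (sized_mono (ngen (inc i))).
Qed.

(** A word longer than all those of [r] is the leading word of the difference. *)
Lemma leading_mono_sub n u r w : sized n r -> (n < wsize (val u))%N ->
  leading leZ (mono k u - r) w <-> w = u.
Proof.
move=> sr nu.
have coef v : (mono k u - r)@_v = (u == v)%:R - r@_v.
  by rewrite mcoeffB mcoeffU.
have supp v : v \in msupp (mono k u - r) -> v = u \/ wsize (val v) = n.
  rewrite -mcoeff_neq0 coef; have [->|_] := eqVneq u v; first by left.
  by rewrite sub0r oppr_eq0 mcoeff_neq0 => /sr; right.
have uin : u \in msupp (mono k u - r).
  rewrite -mcoeff_neq0 coef eqxx mcoeff_outdom ?subr0 ?oner_eq0 //.
  by apply/negP => /sr E; rewrite E ltnn in nu.
split=> [[win wmax]|->]; last first.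
  split=> // v /supp [->|vn] vu; first by rewrite eqxx in vu.
  by apply: word_lt_size; rewrite vn.
have [//|wn] := supp w win; apply/eqP; apply: contraT => wu.
have := word_lt_leq_size (wmax u uin _); rewrite eq_sym => /(_ wu).
by rewrite wn leqNgt nu.
Qed.

Lemma prec_chain_mono w vs :
  prec_chain (mono k w) vs = mono k (nchain w vs).
Proof.
elim: vs w => [//|v vs IH] w; rewrite /prec_chain /= lprec_mono; exact: IH.
Qed.

Lemma wsize_nchain w vs : wsize (val (nchain w vs))
  = (wsize (val w) + sumn [seq wsize (val v) | v <- vs])%N.
Proof.
elim: vs w => [|v vs IH] w /=; first by rewrite addn0.
by rewrite IH wsize_prec addnA.
Qed.

Variables (L : LAlgType k) (I : choiceType) (b : I -> L) (inc : I -> Z).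
Local Notation gen := (gen k inc).

Lemma leading_table d i j w :
  leading leZ (lmul d (gen i) (gen j) - expand b inc (lmul d (b i) (b j))) w
  <-> w = nop d (ngen (inc i)) (ngen (inc j)).
Proof.
rewrite lmul_mono; apply: leading_mono_sub (@sized_expand _ _ b inc _) _.
by case: d.
Qed.

Lemma leading_completion i j vs w :
  leading leZ (lsucc (gen i) (prec_chain (gen j) vs)
               - prec_chain (expand b inc (lsucc (b i) (b j))) vs) w
  <-> w = nsucc (ngen (inc i)) (nchain (ngen (inc j)) vs).
Proof.
rewrite prec_chain_mono lsucc_mono.
apply: leading_mono_sub (@sized_prec_chain _ _ vs (@sized_expand _ _ b inc _)) _.
by rewrite /= wsize_nchain.
Qed.

End Leading.

Section IrrFull.
Variables (k : fieldType) (L1 L2 : LAlgType k) (I J : choiceType).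
Variables (x : I -> L1) (y : J -> L2) (leZ : rel (I + J)%type).
Local Notation Z := (I + J)%type.
Local Notation S := (Sfull x y leZ).

Lemma leading_reducible s w : S s -> leading leZ s w -> ~~ irred (val w).
Proof.
have redex_table d p q : side p = side q -> ~~ irred (val (nop d (ngen p) (ngen q))).
  by move=> pq; case: d; rewrite /= pq eqxx.
have redex_chain p q vs : side p = side q ->
    ~~ irred (val (nsucc (ngen p) (nchain (ngen q) vs))).
  by move=> pq; rewrite /= (@head_nchain _ _ (ngen q) vs q) // pq eqxx !andbF.
case=> [[[|]|]|].
- by case/tableP=> d [i [j ->]] /leading_table ->; apply: redex_table.
- by case/tableP=> d [i [j ->]] /leading_table ->; apply: redex_table.
- case=> i [j [u [vs [_ _ _ ->]]]] /leading_completion ->; exact: redex_chain.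
- case=> i [j [u [vs [_ _ _ ->]]]] /leading_completion ->; exact: redex_chain.
Qed.

Lemma irred_Irr (T : set (free_lalg k Z)) (u : nword Z) :
  (T `<=` S)%classic -> irred (val u) -> Irr leZ T u.
Proof.
move=> TS iu s v w Ts sv lsw _ Eu; move: iu; rewrite Eu.
by move/(irred_wsubst sv); apply/negP; apply: leading_reducible lsw; apply: TS.
Qed.

Section FactorRules.
Variables (A : LAlgType k) (K : choiceType) (b : K -> A) (inc : K -> Z).
Hypothesis tableS : forall s, table b inc s -> S s.
Hypothesis completionS :
  forall s, completion b inc (Irr leZ (S12 x y)) s -> S s.
Hypothesis inc_side : forall i j, side (inc i) = side (inc j).

Lemma table_rule d i j :
  exists2 s, S s & leading leZ s (nop d (ngen (inc i)) (ngen (inc j))).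
Proof.
eexists; last by apply/(leading_table leZ b inc d i j).
by apply/tableS/tableP; exists d, i, j.
Qed.

(** The relation for a chain with right factors is in [completion]: these factors
    are irreducible words, hence lie in [Irr leZ (S12 x y)], and the first is not a
    generator of the same factor as the head, which would absorb it. *)
Lemma chain_rule i j vs :
  irred (val (nchain (ngen (inc j)) vs)) -> (forall v, v \in vs -> irred (val v)) ->
  exists2 s, S s & leading leZ s (nsucc (ngen (inc i)) (nchain (ngen (inc j)) vs)).
Proof.
case: vs => [_ _|u vs ich ivs]; first exact: (table_rule Succ).
eexists; last by apply/(leading_completion leZ b inc i j (u :: vs)).
apply: completionS; exists i, j, u, vs; split=> // [|l Eu|v vin].
- apply: irred_Irr; last by apply: ivs; rewrite mem_head.
  by move=> s Ss; left; left.
- have := irred_nchain (w := nprec (ngen (inc j)) u) (vs := vs) ich.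
  by rewrite Eu /= (inc_side j l) eqxx.
- apply: irred_Irr; last by apply: ivs; rewrite inE vin orbT.
  by move=> s Ss; left; left.
Qed.

End FactorRules.

Lemma redex_leading d (u v : nword Z) :
  irred (val v) -> redex d (val u) (val v) ->
  exists2 s, S s & exists2 w, leading leZ s w & val w = Node d (val u) (val v).
Proof.
have T1 s : table x inl s -> S s by left; left; left.
have T2 s : table y inr s -> S s by left; left; right.
have C1 s : completion x inl (Irr leZ (S12 x y)) s -> S s by left; right.
have C2 s : completion y inr (Irr leZ (S12 x y)) s -> S s by right.
move=> iv; case: d; rewrite /redex.
  case Eu: (val u) => [p|//]; case Ev: (head (val v)) => [q|//] /eqP pq.
  have [vs Evs ivs] := nchain_of_head (valP v) iv Ev.
  rewrite Evs in iv *.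
  have [s Ss ls] : exists2 s, S s & leading leZ s (nsucc (ngen p) (nchain (ngen q) vs)).
    case: p q pq iv {Eu Ev Evs} => [i|j] [i'|j'] // _ iv.
      exact: (chain_rule (b := x)).
    exact: (chain_rule (b := y)).
  by exists s => //; exists (nsucc (ngen p) (nchain (ngen q) vs)).
case Eu: (val u) => [p|//]; case Ev: (val v) => [q|//] /eqP pq.
have [s Ss ls] : exists2 s, S s & leading leZ s (nop Prec (ngen p) (ngen q)).
  case: p q pq {iv Eu Ev} => [i|j] [i'|j'] // _.
    exact: (table_rule (b := x)).
  exact: (table_rule (b := y)).
by exists s => //; exists (nprec (ngen p) (ngen q)).
Qed.

(** A reducible word contains a minimal redex, which is the leading word of a
    relation; and every leading word of a relation is reducible, while a word that
    contains a reducible one is reducible. *)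
Lemma IrrE (u : nword Z) : Irr leZ S u <-> irred (val u).
Proof.
split=> [Iu|]; last exact: irred_Irr.
apply: contraT => /(reducible_occurrence (valP u)).
move=> [t [d [u1 [u2 [st Eu nE /andP[_ i2] rE]]]]].
have /andP[n1 n2] := normal_node nE.
have [s Ss [w lsw Ew]] :=
  redex_leading (u := exist _ u1 n1) (v := exist _ u2 n2) i2 rE.
have := Iu s t w Ss st lsw; rewrite Ew /= -Eu; case=> //; exact: (valP u).
Qed.

End IrrFull.

(** * The basis *)

Section Basis.
Variables (k : fieldType) (L1 L2 : LAlgType k) (I J : choiceType).
Variables (x : I -> L1) (y : J -> L2) (leZ : rel (I + J)%type).
Hypotheses (hx : is_basis x) (hy : is_basis y).
Local Notation Z := (I + J)%type.
Local Notation Q := (lquot (S12 x y)).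
Local Notation B := (set_type (Irr leZ (Sfull x y leZ))).
Local Notation cls := (fun u : B => lpi (S12 x y) (mono k (val u))).

(** The morphism from the quotient to [fused_alg] sends these classes to distinct
    words. *)
Lemma irred_classes_free (c : {malg k[B]}) : lincomb cls c = 0 -> c = 0.
Proof.
have [h [hh h1 h2]] :=
  coproduct_map hx hy (fused_inj1_hom hx hy) (fused_inj2_hom hx hy).
have [lh _ _] := hh.
move=> /(congr1 h); rewrite (lin0 lh) linear_lincomb //.
have -> : (fun u : B => h (cls u)) = (fun u => wpoint hx hy (val (val u))).
  apply/funext => u; rewrite (lpi_mono_weval hx hy) weval_hom //.
  have -> : h \o copair x y (inj1 x y) (inj2 x y)
      = copair x y (fused_inj1 hx hy) (fused_inj2 hx hy).
    by apply/funext => -[i|j]; rewrite /= -?h1 -?h2.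
  apply: weval_irred; first exact: valP.
  by apply/(IrrE x y leZ); exact: set_valP.
rewrite /wpoint point.unlock.
apply: (lincomb_malgU_inj (h := fun u : B => val (val u))) => u v /val_inj/val_inj.
exact.
Qed.

Lemma irred_classes_span (q : Q) : exists c, lincomb cls c = q.
Proof.
have [lp _ _] := lpi_hom (S12 x y).
have Sq : irred_span x y (inj1 x y) (inj2 x y) q.
  rewrite -[q]lpi_reprK; have [c <-] := mono_spans (repr q).
  rewrite linear_lincomb //; apply: subspace_lincomb => [|u _].
    exact: irred_span_subspace.
  rewrite (lpi_mono_weval hx hy).
  exact: irred_span_word hx hy (inj1_hom y hx) (inj2_hom x hy) (val u).
apply: Sq (subspace_range cls) _ => w nw iw.
pose u : nword Z := exist _ w nw.
have uI : u \in Irr leZ (Sfull x y leZ) by apply/mem_set/IrrE.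
exists << SigSub uI >>; rewrite lincombU.
exact: (lpi_mono_weval hx hy u).
Qed.

End Basis.

Theorem corollary5p4 (k : fieldType) (L1 L2 : LAlgType k) (I J : choiceType)
    (x : I -> L1) (y : J -> L2) (leZ : rel (I + J)%type) :
  is_basis x -> is_basis y -> wochoice.well_order leZ ->
  is_coproduct (inj1 x y) (inj2 x y) /\
  is_basis (fun u : set_type (Irr leZ (Sfull x y leZ)) =>
              lpi (S12 x y) (mono k (val u))).
Proof.
move=> hx hy _; split; first exact: lquot_coproduct.
by split; [exact: irred_classes_free | exact: irred_classes_span].
Qed.
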